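(* Let $0<\alpha\le1$, $m\in[0,1]$, $b>0$, and let $h_{1},h_{2}$ be positive $\mathbb{R}^{\alpha}$-valued functions defined on $I\subseteq\mathbb{R}$, where $(0,1)\subseteq I$, such that $h_{2}(\gamma)\le h_{1}(\gamma)$ for all $\gamma\in(0,1)$. If $\mathcal{G}:[0,b]\to\mathbb{R}^{\alpha}$ is generalized $(h_{2}-m)$-convex, then $\mathcal{G}$ is generalized $(h_{1}-m)$-convex.
   Context: For $0<\alpha\le1$, $\mathbb{R}^{\alpha}$ is Yang's fractal set of $\alpha$-type real numbers $a^{\alpha}$ ($a\in\mathbb{R}$), with $a^{\alpha}+b^{\alpha}=(a+b)^{\alpha}$ and $a^{\alpha}b^{\alpha}=(ab)^{\alpha}$ (both operations commutative and associative, multiplication distributing over addition, neutral elements $0^{\alpha}$ and $1^{\alpha}$), ordered by $a^{\alpha}\le b^{\alpha}$ iff $a\le b$. Generalized $(h-m)$-convexity: let $(0,1)\subseteq I\subseteq\mathbb{R}$, let $h:I\to\mathbb{R}^{\alpha}$ be non-negative, and $m\in[0,1]$. A function $\mathcal{G}:[0,b]\to\mathbb{R}^{\alpha}$ is generalized $(h-m)$-convex if it is positive (in the sense $\mathcal{G}\ge0^{\alpha}$) and $\mathcal{G}(\gamma\nu+m(1-\gamma)\mu)\le h(\gamma)\mathcal{G}(\nu)+m^{\alpha}h(1-\gamma)\mathcal{G}(\mu)$ for all $\nu,\mu\in[0,b]$ and all $\gamma\in(0,1)$. *)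

(* Defs.v *)
From HB Require Import structures.
From mathcomp Require Import all_boot all_order all_algebra.
From mathcomp Require Import classical_sets reals.

Set Implicit Arguments.
Unset Strict Implicit.
Unset Printing Implicit Defensive.

Import Order.TTheory GRing.Theory Num.Theory.
Local Open Scope ring_scope.

(* The fractal set of [alpha]-type real numbers. Its elements are the symbols
   a^alpha for a in R, written [fpow alpha a]; a^alpha is formal (it is not the
   real power function, and a may be negative). The index [alpha] is a phantom
   parameter, so distinct exponents give distinct types. *)
Record fractal (R : realType) (alpha : R) := fpow { fbase : R }.

Arguments fpow {R} alpha _.
Arguments fbase {R alpha} _.

Section FractalStructure.
Variables (R : realType) (alpha : R).
Local Notation F := (fractal alpha).
Implicit Types x y z : F.

Lemma fbaseK : cancel (@fbase R alpha) (fpow alpha).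
Proof. by case. Qed.

HB.instance Definition _ := Choice.copy F (can_type fbaseK).

Lemma fbase_inj : injective (@fbase R alpha).
Proof. exact: can_inj fbaseK. Qed.

Definition fractal_add x y : F := fpow alpha (fbase x + fbase y).
Definition fractal_opp x : F := fpow alpha (- fbase x).
Definition fractal_mul x y : F := fpow alpha (fbase x * fbase y).
Definition fractal_inv x : F := fpow alpha (fbase x)^-1.
Definition fractal_norm x : F := fpow alpha `|fbase x|.
Definition fractal_le x y : bool := fbase x <= fbase y.
Definition fractal_lt x y : bool := fbase x < fbase y.

Fact fractal_addA : associative fractal_add.
Proof. by move=> x y z; congr fpow; rewrite /= addrA. Qed.

Fact fractal_addC : commutative fractal_add.
Proof. by move=> x y; congr fpow; rewrite addrC. Qed.

Fact fractal_add0 : left_id (fpow alpha 0) fractal_add.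
Proof. by move=> x; apply: fbase_inj; rewrite /= add0r. Qed.

Fact fractal_addN : left_inverse (fpow alpha 0) fractal_opp fractal_add.
Proof. by move=> x; congr fpow; rewrite /= addNr. Qed.

HB.instance Definition _ := GRing.isZmodule.Build F
  fractal_addA fractal_addC fractal_add0 fractal_addN.

Fact fractal_mulA : associative fractal_mul.
Proof. by move=> x y z; congr fpow; rewrite /= mulrA. Qed.

Fact fractal_mulC : commutative fractal_mul.
Proof. by move=> x y; congr fpow; rewrite mulrC. Qed.

Fact fractal_mul1 : left_id (fpow alpha 1) fractal_mul.
Proof. by move=> x; apply: fbase_inj; rewrite /= mul1r. Qed.

Fact fractal_mulDl : left_distributive fractal_mul fractal_add.
Proof. by move=> x y z; congr fpow; rewrite /= mulrDl. Qed.

Fact fractal_1_neq0 : fpow alpha 1 != fpow alpha 0.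
Proof. by apply/eqP => -[] /eqP; rewrite oner_eq0. Qed.

HB.instance Definition _ := GRing.Zmodule_isComNzRing.Build F
  fractal_mulA fractal_mulC fractal_mul1 fractal_mulDl fractal_1_neq0.

Fact fractal_mulVf x : x != 0 -> fractal_inv x * x = 1.
Proof. by move=> x0; apply: fbase_inj; rewrite /= mulVf. Qed.

Fact fractal_inv0 : fractal_inv 0 = 0.
Proof. by apply: fbase_inj; rewrite /= invr0. Qed.

HB.instance Definition _ :=
  GRing.ComNzRing_isField.Build F fractal_mulVf fractal_inv0.

Fact fractal_le0_add x y :
  fractal_le 0 x -> fractal_le 0 y -> fractal_le 0 (x + y).
Proof. exact: addr_ge0. Qed.

Fact fractal_le0_mul x y :
  fractal_le 0 x -> fractal_le 0 y -> fractal_le 0 (x * y).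
Proof. exact: mulr_ge0. Qed.

Fact fractal_le0_anti x : fractal_le 0 x -> fractal_le x 0 -> x = 0.
Proof. by move=> x0 x0'; apply/fbase_inj/le_anti/andP. Qed.

Fact fractal_sub_ge0 x y : fractal_le 0 (y - x) = fractal_le x y.
Proof. exact: subr_ge0. Qed.

Fact fractal_le0_total x : fractal_le 0 x || fractal_le x 0.
Proof. exact: le_total. Qed.

Fact fractal_normN x : fractal_norm (- x) = fractal_norm x.
Proof. by congr fpow; rewrite /= normrN. Qed.

Fact fractal_ge0_norm x : fractal_le 0 x -> fractal_norm x = x.
Proof. by move=> x0; apply: fbase_inj; rewrite /= ger0_norm. Qed.

Fact fractal_lt_def x y : fractal_lt x y = (y != x) && fractal_le x y.
Proof. by rewrite /fractal_lt lt_def (inj_eq fbase_inj). Qed.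

HB.instance Definition _ := Num.IntegralDomain_isLeReal.Build F
  fractal_le0_add fractal_le0_mul fractal_le0_anti fractal_sub_ge0
  fractal_le0_total fractal_normN fractal_ge0_norm fractal_lt_def.

Lemma fpow0 : fpow alpha 0 = 0.
Proof. by []. Qed.

Lemma fpow1 : fpow alpha 1 = 1.
Proof. by []. Qed.

Lemma fpowD (a b : R) : fpow alpha a + fpow alpha b = fpow alpha (a + b).
Proof. by []. Qed.

Lemma fpowM (a b : R) : fpow alpha a * fpow alpha b = fpow alpha (a * b).
Proof. by []. Qed.

Lemma fpow_le (a b : R) : (fpow alpha a <= fpow alpha b) = (a <= b).
Proof. by []. Qed.

End FractalStructure.

(* [G] and [h] are total functions of which only the values on [0, b],
   respectively on ]0, 1[, are used. The real coefficient [m] multiplies the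
   argument of [G], whereas its fractal power m^alpha multiplies the value. *)
Definition generalized_hm_convex (R : realType) (alpha : R)
    (h : R -> fractal alpha) (m b : R) (G : R -> fractal alpha) : Prop :=
  (forall x : R, x \in `[0, b] -> 0 <= G x) /\
  (forall nu mu gamma : R,
     nu \in `[0, b] -> mu \in `[0, b] -> gamma \in `]0, 1[ ->
     G (gamma * nu + m * (1 - gamma) * mu) <=
       h gamma * G nu + fpow alpha m * h (1 - gamma) * G mu).

(* Main.v *)
Require Import Defs.
From mathcomp Require Import all_boot all_order all_algebra.
From mathcomp Require Import classical_sets reals.
Import Order.TTheory GRing.Theory Num.Theory.
Local Open Scope ring_scope.

Theorem proposition1 (R : realType) (alpha m b : R)
    (alpha_gt0 : 0 < alpha) (alpha_le1 : alpha <= 1)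
    (m_ge0 : 0 <= m) (m_le1 : m <= 1) (b_gt0 : 0 < b)
    (I : set R) (subI : forall gamma : R, gamma \in `]0, 1[ -> I gamma)
    (h1 h2 : R -> fractal alpha)
    (h1_ge0 : forall t : R, I t -> 0 <= h1 t)
    (h2_ge0 : forall t : R, I t -> 0 <= h2 t)
    (h2_le_h1 : forall gamma : R, gamma \in `]0, 1[ -> h2 gamma <= h1 gamma)
    (G : R -> fractal alpha) :
  generalized_hm_convex h2 m b G -> generalized_hm_convex h1 m b G.
Proof.
move=> [G_ge0 G_conv]; split=> // nu mu gamma nuI muI gammaI.
have gamma'I : 1 - gamma \in `]0, 1[.
  by move: gammaI; rewrite !in_itv /= subr_gt0 ltrBlDr ltrDl andbC.
apply: le_trans (G_conv _ _ _ nuI muI gammaI) _.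
(* The upper bound is monotone in h, since its coefficients G nu, G mu and
   m^alpha are nonnegative and ]0, 1[ is stable under gamma |-> 1 - gamma. *)
have malpha_ge0 : 0 <= fpow alpha m by rewrite -fpow0 fpow_le.
apply: lerD; apply: ler_wpM2r; rewrite ?G_ge0 ?h2_le_h1 //.
by apply: ler_wpM2l; rewrite ?h2_le_h1.
Qed.
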